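(* Let $n\ge 3$ and let $K$ be a field. Then $K[C_n]$ embeds into the matrix algebra $M_r(L)$ over a field $L$, for some $r\geqslant 1$.
   Context: For $n\ge 3$, $C_n$ is the monoid generated by $x_1,\dots,x_n$ with relations (indices modulo $n$) $x_i^2=x_i$; $x_ix_j=x_jx_i$ if $i,j$ are distinct and not cyclically adjacent; $x_ix_{i+1}x_i=x_{i+1}x_ix_{i+1}=x_ix_{i+1}$. $K[C_n]$ is its monoid algebra over $K$. *)

(* Defs.v *)
From HB Require Import structures.
From mathcomp Require Import all_boot all_algebra.
From mathcomp Require Import boolp.
From mathcomp Require Export monalg.

Set Implicit Arguments.
Unset Strict Implicit.
Unset Printing Implicit Defensive.

Import GRing.Theory.
Local Open Scope quotient_scope.

Section HeckeKiselmanCycle.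
Variable n : nat.
Implicit Types (i j : 'I_n) (u v w : seq 'I_n).

(* Words in the generators are sequences over 'I_n (the generators x_1, ..,
   x_n are numbered from 0), and ordS is the cyclic successor i |-> i + 1. *)
Variant hk_rel : seq 'I_n -> seq 'I_n -> Prop :=
| HKidem i : hk_rel [:: i; i] [:: i]
| HKcomm i j : i != j -> j != ordS i -> i != ordS j ->
    hk_rel [:: i; j] [:: j; i]
| HKbraidl i : hk_rel [:: i; ordS i; i] [:: i; ordS i]
| HKbraidr i : hk_rel [:: ordS i; i; ordS i] [:: i; ordS i].

(* The smallest congruence on the free monoid that contains hk_rel. *)
Inductive hk_cong : seq 'I_n -> seq 'I_n -> Prop :=
| HKrel u v : hk_rel u v -> hk_cong u v
| HKrefl u : hk_cong u u
| HKsym u v : hk_cong u v -> hk_cong v u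
| HKtrans v u w : hk_cong u v -> hk_cong v w -> hk_cong u w
| HKcat u u' v v' : hk_cong u u' -> hk_cong v v' ->
    hk_cong (u ++ v) (u' ++ v').

Definition hk_eq : rel (seq 'I_n) := fun u v => `[< hk_cong u v >].

Lemma hk_eq_refl : reflexive hk_eq.
Proof. by move=> u; apply/asboolP; apply: HKrefl. Qed.

Lemma hk_eq_sym : symmetric hk_eq.
Proof. by move=> u v; apply/asboolP/asboolP; apply: HKsym. Qed.

Lemma hk_eq_trans : transitive hk_eq.
Proof.
move=> v u w /asboolP uv /asboolP vw.
by apply/asboolP; apply: HKtrans uv vw.
Qed.

Canonical hk_equiv := EquivRel hk_eq hk_eq_refl hk_eq_sym hk_eq_trans.

Definition hk_monoid : Type := {eq_quot hk_equiv}.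

HB.instance Definition _ := Choice.on hk_monoid.
HB.instance Definition _ := EqQuotient.on hk_monoid.

Definition hk_gen i : hk_monoid := \pi_hk_monoid [:: i].

Definition hk_one : hk_monoid := \pi_hk_monoid [::].

Definition hk_mul (x y : hk_monoid) : hk_monoid :=
  \pi_hk_monoid (repr x ++ repr y).

Lemma hk_piP u v : reflect (hk_cong u v) (u == v %[mod hk_monoid]).
Proof. by rewrite eqmodE; apply: asboolP. Qed.

Lemma hk_repr_pi u : hk_cong (repr (\pi_hk_monoid u)) u.
Proof. by apply/hk_piP; rewrite reprK. Qed.

Lemma hk_mul_pi u v :
  hk_mul (\pi_hk_monoid u) (\pi_hk_monoid v) = \pi_hk_monoid (u ++ v).
Proof. by apply/eqP/hk_piP; apply: HKcat; apply: hk_repr_pi. Qed.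

Lemma hk_monoidW (P : hk_monoid -> Prop) :
  (forall u, P (\pi_hk_monoid u)) -> forall x, P x.
Proof. by move=> Ppi x; rewrite -[x]reprK. Qed.

Lemma hk_mulA : associative hk_mul.
Proof.
elim/hk_monoidW=> u; elim/hk_monoidW=> v; elim/hk_monoidW=> w.
by rewrite !hk_mul_pi catA.
Qed.

Lemma hk_mul1m : left_id hk_one hk_mul.
Proof. by elim/hk_monoidW=> u; rewrite hk_mul_pi. Qed.

Lemma hk_mulm1 : right_id hk_one hk_mul.
Proof. by elim/hk_monoidW=> u; rewrite hk_mul_pi cats0. Qed.

Lemma hk_cong_nilp u v : hk_cong u v -> nilp u = nilp v.
Proof.
elim=> {u v} [u v [] //|//|//|v u w _ -> _ ->|u u' v v' _ + _] //.
by rewrite /nilp !size_cat !addn_eq0 => -> ->.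
Qed.

Lemma hk_unitm x y : hk_mul x y = hk_one -> x = hk_one /\ y = hk_one.
Proof.
elim/hk_monoidW: x => u; elim/hk_monoidW: y => v; rewrite hk_mul_pi.
by move=> /eqP/hk_piP/hk_cong_nilp; case: u => //=; case: v.
Qed.

HB.instance Definition _ := Choice_isMonomialDef.Build hk_monoid
  hk_mulA hk_mul1m hk_mulm1 hk_unitm.

Lemma hk_mulE u v :
  mmul (\pi_hk_monoid u) (\pi_hk_monoid v) = \pi_hk_monoid (u ++ v).
Proof. exact: hk_mul_pi. Qed.

Lemma hk_pi_rel u v : hk_rel u v -> \pi_hk_monoid u = \pi_hk_monoid v.
Proof. by move=> uv; apply/eqP/hk_piP; apply: HKrel. Qed.

Lemma hk_gen_idem i : mmul (hk_gen i) (hk_gen i) = hk_gen i.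
Proof. by rewrite /hk_gen hk_mulE; apply: hk_pi_rel; apply: HKidem. Qed.

Lemma hk_gen_comm i j : i != j -> j != ordS i -> i != ordS j ->
  mmul (hk_gen i) (hk_gen j) = mmul (hk_gen j) (hk_gen i).
Proof.
by move=> ij ji1 ij1; rewrite /hk_gen !hk_mulE; apply: hk_pi_rel; apply: HKcomm.
Qed.

Lemma hk_gen_braidl i :
  mmul (mmul (hk_gen i) (hk_gen (ordS i))) (hk_gen i) =
  mmul (hk_gen i) (hk_gen (ordS i)).
Proof. by rewrite /hk_gen !hk_mulE; apply: hk_pi_rel; apply: HKbraidl. Qed.

Lemma hk_gen_braidr i :
  mmul (mmul (hk_gen (ordS i)) (hk_gen i)) (hk_gen (ordS i)) =
  mmul (hk_gen i) (hk_gen (ordS i)).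
Proof. by rewrite /hk_gen !hk_mulE; apply: hk_pi_rel; apply: HKbraidr. Qed.

End HeckeKiselmanCycle.

(* Main.v *)
Require Import Defs.
From HB Require Import structures.
From mathcomp Require Import all_boot all_algebra.
From mathcomp Require Import boolp finmap zify.

Set Implicit Arguments.
Unset Strict Implicit.
Unset Printing Implicit Defensive.

Import GRing.Theory.
Local Open Scope ring_scope.

(** The monoid C_n acts on the natural numbers: the generator x_i moves every
    particle standing at a position congruent to i modulo n one step to the
    right, and fixes the other positions.  A word thus gives an extensive,
    order-preserving map that commutes with the translation by n.

    This action is faithful ([act_inj]), for two reasons.  If the action of u
    identifies i and i + 1, then x_i u = u, since letting i join i + 1 at the
    start changes nothing ([gen_absorb]).  Moreover x_i u does not depend on
    where u sends i, so u can be replaced by a word that keeps i as far back as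
    order-preservation allows ([gen_postpone]).  Hence, if u and v act in the
    same way and not injectively, let i be the first element of a fibre with
    more than one element, and write u = x_i u' and v = x_i v', where u' and v'
    act in the same way but with a smaller total displacement; induction gives
    u' = v'.  A nonempty word never acts injectively, which is the base of the
    induction.

    A faithful action does not make the monoid algebra act faithfully on the
    span of the positions, but it does on configurations.  A configuration
    records the positions of n particles modulo 2n, and the number of turns
    made by the first particle is recorded as a power of 'X.  This gives
    monomial matrices over {poly K}.  Because an order-preserving map that
    commutes with the translation by n keeps the images of 0, .., n - 1 in a
    window of length n, these residues and this number of turns determine the
    map ([config_id_separates]).  So the row of the identity configuration has
    its single nonzero entry at different places, or with different powers of
    'X, for different elements of C_n, and the matrices are linearly independent
    over K ([frac_lift_inj]).  The field L is the fraction field of {poly K}. *)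

Local Notation "x * y" := (mmul x y) : monom_scope.

(** * The action by moving particles *)

Section Particles.
Local Open Scope nat_scope.
Variable n : nat.
Hypothesis n_ge3 : 3 <= n.
Implicit Types (i j : 'I_n) (u v w : seq 'I_n) (p q k : nat).

Definition step p i := if p %% n == i then p.+1 else p.

Definition act u p := foldl step p u.

Lemma act_cat u v p : act (u ++ v) p = act v (act u p).
Proof. exact: foldl_cat. Qed.

Lemma act_cons i u p : act (i :: u) p = act u (step p i).
Proof. by []. Qed.

Lemma act_addM u p k : act u (p + k * n) = act u p + k * n.
Proof.
elim: u p => //= i u IHu p; rewrite -IHu; congr (act u _).
rewrite /step [p + _]addnC modnMDl [_ + p]addnC.
by case: ifP => // _; rewrite addSn.
Qed.

Lemma act_addn u p : act u (p + n) = act u p + n.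
Proof. by have := act_addM u p 1; rewrite mul1n. Qed.

Lemma leq_act_id u p : p <= act u p.
Proof.
elim: u p => //= i u IHu p; apply: leq_trans (IHu _).
by rewrite /step; case: ifP.
Qed.

Lemma leq_step i : {homo step ^~ i : p q / p <= q}.
Proof.
move=> p q; rewrite leq_eqVlt => /orP[/eqP-> //|ltpq].
by rewrite /step; case: ifP => _; case: ifP => _; lia.
Qed.

Lemma leq_act u : {homo act u : p q / p <= q}.
Proof. by elim: u => //= i u IHu p q /(leq_step i)/IHu. Qed.

(** The invariance under translation by n lets an equality be checked at the
    most convenient representative of a residue class; this is how the cyclic
    indices are handled below. *)
Lemma eq_act_mod u v p q :
  p = q %[mod n] -> act u p = act v p -> act u q = act v q.
Proof.
move=> eqpq.
rewrite (divn_eq p n) (divn_eq q n) eqpq !(addnC (_ * n)) !act_addM.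
by move=> /addIn->.
Qed.

Lemma n_gt0 : 0 < n. Proof. exact: ltn_trans n_ge3. Qed.

(** Indexing the generators by all natural numbers makes the successor of an
    index and the position next to it the same operation. *)
Definition letter p : 'I_n := Ordinal (ltn_pmod p n_gt0).

Lemma letter_ord i : letter i = i.
Proof. by apply/val_inj; rewrite /= modn_small. Qed.

Lemma eq_letter p q : (letter p == letter q) = (p == q %[mod n]).
Proof. by []. Qed.

Lemma ordS_letter p : ordS (letter p) = letter p.+1.
Proof. by apply/val_inj; rewrite /= -addn1 modnDml addn1. Qed.

Lemma neq_modn_small p d : 0 < d < n -> (p == p + d %[mod n]) = false.
Proof.
move=> /andP[d0 dn]; rewrite -{1}[p]addn0 eqn_modDl mod0n modn_small //.
by case: d d0 {dn}.
Qed.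

Lemma stepE p q : step q (letter p) = if q == p %[mod n] then q.+1 else q.
Proof. by []. Qed.

Lemma modnSS p q : (p.+1 == q.+1 %[mod n]) = (p == q %[mod n]).
Proof. by rewrite -(addn1 p) -(addn1 q) eqn_modDr. Qed.

Lemma modn_neq1 p : (p == p.+1 %[mod n]) = false.
Proof. by rewrite -addn1 neq_modn_small // (ltn_trans _ n_ge3). Qed.

Lemma modn_neq2 p : (p == p.+2 %[mod n]) = false.
Proof. by rewrite -addn2 neq_modn_small. Qed.

Lemma step_miss p q : (q == p %[mod n]) = false -> step q (letter p) = q.
Proof. by rewrite stepE => ->. Qed.

(** The last two equations are where 3 <= n is used: in a cycle of length 2
    the positions p and p + 2 would be moved together. *)
Lemma step_near p :
  ((step p (letter p) = p.+1) * (step p (letter p.+1) = p)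
  * (step p.+1 (letter p) = p.+1) * (step p (letter p.+2) = p)
  * (step p.+2 (letter p) = p.+2))%type.
Proof.
by do ![split]; rewrite stepE ?eqxx // 1?eq_sym ?modn_neq1 ?modn_neq2 //;
  rewrite eq_sym ?modn_neq1 ?modn_neq2.
Qed.

Lemma hk_rel_act u v : hk_rel u v -> act u =1 act v.
Proof.
case=> [i|i j nij njSi niSj|i|i] q.
- rewrite -(letter_ord i); have [/eqP e|/negPf ne] := boolP (q == i %[mod n]).
    by apply: eq_act_mod (esym e) _; rewrite /= !step_near.
  by rewrite /= !(step_miss ne).
- move: nij njSi niSj; rewrite -(letter_ord i) -(letter_ord j) !ordS_letter.
  rewrite !eq_letter.
  rewrite [j == i.+1 %[mod n]]eq_sym => /negPf nij /negPf nSij /negPf niSj.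
  have [/eqP e|/negPf nqi] := boolP (q == i %[mod n]).
    apply: eq_act_mod (esym e) _.
    by rewrite /= (step_miss nij) step_near (step_miss nSij).
  have [/eqP e|/negPf nqj] := boolP (q == j %[mod n]).
    rewrite eq_sym in nij; rewrite eq_sym in niSj.
    apply: eq_act_mod (esym e) _.
    by rewrite /= (step_miss nij) step_near (step_miss niSj).
  by rewrite /= (step_miss nqi) (step_miss nqj) (step_miss nqi).
- rewrite -(letter_ord i) ordS_letter.
  have [/eqP e|/negPf nq0] := boolP (q == i %[mod n]).
    by apply: eq_act_mod (esym e) _; rewrite /= !step_near.
  have [/eqP e|/negPf nq1] := boolP (q == i.+1 %[mod n]).
    by apply: eq_act_mod (esym e) _; rewrite /= !step_near.
  by rewrite /= (step_miss nq0) (step_miss nq1) (step_miss nq0).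
- rewrite -(letter_ord i) ordS_letter.
  have [/eqP e|/negPf nq0] := boolP (q == i %[mod n]).
    by apply: eq_act_mod (esym e) _; rewrite /= !step_near.
  have [/eqP e|/negPf nq1] := boolP (q == i.+1 %[mod n]).
    by apply: eq_act_mod (esym e) _; rewrite /= !step_near.
  by rewrite /= (step_miss nq1) (step_miss nq0) (step_miss nq1).
Qed.

Lemma hk_cong_act u v : hk_cong u v -> act u =1 act v.
Proof.
elim=> {u v} [u v|//|u v _ IH p|v u w _ IHu _ IHv p|u u' v v' _ IHu _ IHv p].
- exact: hk_rel_act.
- by rewrite IH.
- by rewrite IHu IHv.
- by rewrite !act_cat IHu IHv.
Qed.

(** * Faithfulness of the action *)

Local Notation cl u := (\pi_(hk_monoid n) u)%qT.
Local Notation gen p := (hk_gen (letter p)).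

Lemma pi_cons p u : cl (letter p :: u) = (gen p * cl u)%M.
Proof. by rewrite hk_mulE. Qed.

Lemma genK p (x : hk_monoid n) : (gen p * (gen p * x) = gen p * x)%M.
Proof. by rewrite mulmA hk_gen_idem. Qed.

Lemma gen_comm p q (x : hk_monoid n) :
    p != q %[mod n] -> q != p.+1 %[mod n] -> p != q.+1 %[mod n] ->
  (gen p * (gen q * x) = gen q * (gen p * x))%M.
Proof. by move=> *; rewrite !mulmA hk_gen_comm ?ordS_letter. Qed.

Lemma gen_braidl p (x : hk_monoid n) :
  (gen p * (gen p.+1 * (gen p * x)) = gen p * (gen p.+1 * x))%M.
Proof. by rewrite -ordS_letter !mulmA hk_gen_braidl. Qed.

Lemma gen_braidr p (x : hk_monoid n) :
  (gen p.+1 * (gen p * (gen p.+1 * x)) = gen p * (gen p.+1 * x))%M.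
Proof. by rewrite -ordS_letter !mulmA hk_gen_braidr. Qed.

(** By induction on u = x_j u'.  When j = p, the hypothesis passes to u', which
    thus absorbs the generator p + 1, and a braid relation carries this over
    to u.  When j = p + 2, it says that u' identifies three consecutive
    positions, so u' absorbs both generators. *)
Lemma gen_absorb u p :
  act u p.+1 = act u p.+2 -> (gen p.+1 * cl u = cl u)%M.
Proof.
elim: u p => [p /eqP|j u IHu p]; first by rewrite eqn_leq ltnn andbF.
rewrite -(letter_ord j) !act_cons pi_cons.
have [/eqP ej|nj1] := boolP (letter p.+1 == letter j).
  by rewrite -ej genK.
have [/eqP <-|nj2] := boolP (letter p.+2 == letter j).
  rewrite !step_near => eq13.
  have eq12 : act u p.+1 = act u p.+2.
    by apply/eqP; rewrite eqn_leq leq_act //= eq13 leq_act.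
  have eq23 : act u p.+2 = act u p.+3 by rewrite -eq12.
  by rewrite (IHu _ eq23) IHu.
have [/eqP <-|nj0] := boolP (letter p == letter j).
  by rewrite !step_near => /IHu <-; rewrite gen_braidr.
rewrite !step_miss -?eq_letter ?(negPf nj1) ?(negPf nj2) // => /IHu e.
by rewrite gen_comm ?modnSS -?eq_letter ?e // eq_sym.
Qed.

(** After the generator p + 1 nothing is left at the position p + 1, so the
    image of p + 1 under the rest of the word is free; it can be brought down
    to the lower bound forced by the image of p and by extensivity.  The one
    index that needs an idea is j = p + 2: a second generator p + 1 is created
    by the braid relation, so that the induction applies behind p + 2. *)
Lemma gen_postpone u p : exists w,
  [/\ (gen p.+1 * cl u = gen p.+1 * cl w)%M,
      act w p.+1 = maxn p.+1 (act u p) &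
      forall q, q != p.+1 %[mod n] -> act w q = act u q].
Proof.
elim: u => [|j u [w [eqw wp wq]]].
  by exists [::]; split=> //=; rewrite (maxn_idPl (leqnSn p)).
rewrite -(letter_ord j) pi_cons.
have [/eqP ej|nj1] := boolP (letter p.+1 == letter j).
  rewrite -ej genK; exists w; split=> // [|q nqp].
    by rewrite wp act_cons step_near.
  by rewrite wq // act_cons step_miss ?(negPf nqp).
have [/eqP <-|nj2] := boolP (letter p.+2 == letter j).
  exists (letter p.+2 :: w); split=> [||q nqp].
  - by rewrite pi_cons -gen_braidl eqw gen_braidl.
  - by rewrite !act_cons !step_near.
  - rewrite !act_cons wq // stepE; case: ifP => [/eqP e|_ //].
    by rewrite modnSS e eq_sym modn_neq2.
have [/eqP <-|nj0] := boolP (letter p == letter j).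
  (* Here p is moved onto p + 1, so the image of p + 1 is already minimal. *)
  exists (letter p :: u); split=> //; first by rewrite pi_cons.
  rewrite !act_cons !step_near.
  by rewrite (maxn_idPr (leq_act_id u p.+1)).
have comm x : (gen p.+1 * (gen j * x) = gen j * (gen p.+1 * x))%M.
  by apply: gen_comm; rewrite ?modnSS -?eq_letter // eq_sym.
exists (letter j :: w); split=> [||q nqp].
- by rewrite pi_cons comm eqw comm.
- by rewrite !act_cons !step_miss -?eq_letter ?(negPf nj1) ?(negPf nj0).
- rewrite !act_cons wq // stepE; case: ifP => [/eqP e|_ //].
  by rewrite modnSS e eq_sym -eq_letter.
Qed.

(** A fibre of the action is an interval with at most n elements, so it has a
    first element; translating by n makes sure that this element is not cut
    off at the position 0. *)
Lemma exists_first_collision u p : act u p = act u p.+1 ->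
  exists2 q, act u q < act u q.+1 & act u q.+1 = act u q.+2.
Proof.
move=> eqp; set y := act u (p + n).
have eqy : act u (p + n).+1 = y by rewrite -addSn /y !act_addn eqp.
have exq : exists q, act u q == y by exists (p + n).
case: (ex_minnP exq) => -[|q] /eqP uq minq.
  have := leq_act u (leq_addl p n); rewrite -/y -uq -[n]add0n act_addn.
  by have := n_gt0; lia.
have ltqy : act u q < y.
  rewrite ltn_neqAle -uq leq_act // andbT uq; apply/negP => /minq.
  by rewrite ltnn.
exists q; rewrite uq //; apply/eqP; rewrite eqn_leq -{1}uq leq_act //=.
by rewrite -eqy leq_act // ltnS minq.
Qed.

(** Induction on the total displacement.  The collision is taken at the
    beginning of a fibre so that [gen_postpone] strictly lowers the image of
    its first element. *)
Lemma act_inj u v : act u =1 act v -> cl u = cl v.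
Proof.
have [m] := ubnP (\sum_(i < n) act u i); elim: m u v => [|m IHm] u v ltm equv.
  by rewrite ltn0 in ltm.
have [[p eqp]|noeq] := pselect (exists p, act u p = act u p.+1); last first.
  have nil w : act u =1 act w -> w = [::].
    case: w => // j w; rewrite -(letter_ord j) => eqw; case: noeq; exists j.
    by rewrite !eqw !act_cons !step_near.
  by rewrite (nil u) // (nil v) // => p; rewrite equv.
have [q ltq eqq] := exists_first_collision eqp.
have eqvq : act v q.+1 = act v q.+2 by rewrite -!equv.
rewrite -(gen_absorb eqq) -(gen_absorb eqvq).
have [w [-> wq wE]] := gen_postpone u q.
have [w' [-> wq' wE']] := gen_postpone v q.
congr (_ * _)%M; apply: IHm => [|k]; last first.
  have [/eqP e|ne] := boolP (k == q.+1 %[mod n]); last by rewrite wE // wE'.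
  by apply: eq_act_mod (esym e) _; rewrite wq wq' equv.
rewrite -ltnS; apply: leq_trans ltm; rewrite ltnS.
have ltw : act w (letter q.+1) < act u (letter q.+1).
  have actE x : act x q.+1 = act x (letter q.+1) + q.+1 %/ n * n.
    by rewrite -act_addM addnC -divn_eq.
  by rewrite -(ltn_add2r (q.+1 %/ n * n)) -!actE wq gtn_max ltq eqq leq_act_id.
rewrite (bigD1 (letter q.+1)) //= [leqRHS](bigD1 (letter q.+1)) //= -addSn.
apply: leq_add => //; apply: leq_sum => i ni; rewrite wE //.
by apply: contra ni => /eqP e; apply/eqP/val_inj; rewrite /= -e modn_small.
Qed.

End Particles.

(** * Monoid algebras with a separating row of monomials *)

Section MonomialRow.
Variables (M : monomType) (K : fieldType) (r : nat).
Variable h : {mmorphism M -> 'M[{poly K}]_r.+1}.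

Definition poly_lift : {malg K[M]} -> 'M[{poly K}]_r.+1 :=
  mmap ((@scalar_mx _ _) \o polyC) h.

Definition frac_lift (g : {malg K[M]}) : 'M[{fraction {poly K}}]_r.+1 :=
  map_mx (@tofrac _) (poly_lift g).

Lemma frac_lift_additive : additive frac_lift.
Proof. by move=> g1 g2; rewrite /frac_lift /poly_lift raddfB map_mxB. Qed.

Lemma frac_lift_multiplicative : multiplicative frac_lift.
Proof.
have [lM l1] : multiplicative poly_lift.
  apply: commr_mmap_is_multiplicative => g m m'; apply: esym; exact: scalar_mxC.
by split=> [g1 g2|]; rewrite /frac_lift ?lM ?l1 ?map_mxM ?map_mx1.
Qed.

Definition const_frac : {rmorphism K -> {fraction {poly K}}} :=
  GRing.RMorphism.clone _ _ (@tofrac _ \o polyC) _.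

Lemma frac_lift_scalable : scalable_for (const_frac \; *:%R) frac_lift.
Proof.
move=> c g; rewrite /frac_lift /poly_lift mmapZ [_ * _]mul_scalar_mx.
by rewrite map_mxZ.
Qed.

HB.instance Definition _ :=
  GRing.isAdditive.Build _ _ frac_lift frac_lift_additive.
HB.instance Definition _ :=
  GRing.isMultiplicative.Build _ _ frac_lift frac_lift_multiplicative.
HB.instance Definition _ :=
  GRing.isScalable.Build _ _ _ _ frac_lift frac_lift_scalable.

(** The coefficient of g at x can be read off the image of g: it is the
    coefficient of 'X^(e x) in the entry of row a and column s x. *)
Lemma frac_lift_inj (a : 'I_r.+1) (s : M -> 'I_r.+1) (e : M -> nat) :
    (forall x b, h x a b = 'X^(e x) *+ (s x == b)) ->
    (forall x y, s x = s y -> e x = e y -> x = y) ->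
  injective frac_lift.
Proof.
move=> hE inj_se; apply: raddf_inj => g g0; apply/malgP => x; rewrite mcoeff0.
have := congr1 (fun A : 'M_r.+1 => A a (s x)) g0.
rewrite !mxE -[0](tofrac0 {poly K}) => /eqP; rewrite tofrac_eq => /eqP.
rewrite /poly_lift mmapE summxE => /(congr1 (coefp (e x))) /=.
rewrite coef0 coef_sum.
have term y : (((g@_y)%:P)%:M * h y) a (s x) =
    (g@_y)%:P * 'X^(e y) *+ (s y == s x).
  by rewrite [_%:M * _]mul_scalar_mx mxE hE mulrnAr.
case: (msuppP g x) => [|//] xg.
rewrite (big_rem x) //= big1_seq ?addr0.
  by rewrite term eqxx mulr1n coefCM coefXn eqxx mulr1.
move=> y /=; rewrite (mem_rem_uniq x (fset_uniq _)) => /andP[nyx _].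
rewrite term; case: eqP => [esy|_]; last by rewrite coef0.
rewrite mulr1n coefCM coefXn; case: eqP => [ee|_]; last by rewrite mulr0.
by case/eqP: nyx; apply: inj_se.
Qed.

End MonomialRow.

(** * The representation on configurations *)

Section Representation.
Variables (n : nat) (n_ge3 : (3 <= n)%N).
Implicit Types (u v w : seq 'I_n).

Local Notation N := (n + n)%N.

Lemma N_gt0 : (0 < N)%N. Proof. by rewrite addn_gt0 (n_gt0 n_ge3). Qed.

(** The modulus is 2n and not n because the images of two of the positions
    0, .., n - 1 can be exactly n apart, which residues modulo n do not see. *)
Definition config := {ffun 'I_n -> 'I_N}.

Definition config_act u (c : config) : config :=
  [ffun i => Ordinal (ltn_pmod (act u (c i)) N_gt0)].

Definition particle0 : 'I_n := Ordinal (n_gt0 n_ge3).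

(** The turns of a single particle suffice: those of the other ones follow from
    the window in which the particles stay. *)
Definition winding u (c : config) : nat := (act u (c particle0) %/ N)%N.

Lemma act_mod u p : act u p = (act u (p %% N) + p %/ N * N)%N.
Proof.
have dblE k : (k * N = k * 2 * n)%N by rewrite -mulnA mul2n addnn.
by rewrite {1}(divn_eq p N) addnC dblE act_addM.
Qed.

Lemma config_act_nil c : config_act [::] c = c.
Proof. by apply/ffunP => i; apply/val_inj; rewrite ffunE /= modn_small. Qed.

Lemma winding_nil c : winding [::] c = 0%N.
Proof. exact: divn_small (ltn_ord _). Qed.

Lemma act_cat_config u v (c : config) i :
  act (u ++ v) (c i) = (act v (config_act u c i) + act u (c i) %/ N * N)%N.
Proof. by rewrite act_cat (act_mod v) ffunE. Qed.

Lemma config_act_cat u v c :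
  config_act (u ++ v) c = config_act v (config_act u c).
Proof.
apply/ffunP => i; apply/val_inj; rewrite ffunE [in RHS]ffunE /=.
by rewrite act_cat_config addnC modnMDl.
Qed.

(** The cocycle identity that makes [act_mx] multiplicative. *)
Lemma winding_cat u v c :
  winding (u ++ v) c = (winding u c + winding v (config_act u c))%N.
Proof. by rewrite /winding act_cat_config divnDMl ?N_gt0 // addnC. Qed.

Lemma eq_config_act u v c : act u =1 act v -> config_act u c = config_act v c.
Proof.
by move=> equv; apply/ffunP => i; apply/val_inj; rewrite !ffunE /= equv.
Qed.

Lemma eq_winding u v c : act u =1 act v -> winding u c = winding v c.
Proof. by move=> equv; rewrite /winding equv. Qed.

Definition config_id : config := [ffun i => widen_ord (leq_addr n n) i].

(** The winding gives the image of 0.  The image of i < n exceeds it by at most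
    n < 2n, so it is determined by its residue modulo 2n. *)
Lemma config_id_separates u v :
    config_act u config_id = config_act v config_id ->
    winding u config_id = winding v config_id ->
  act u =1 act v.
Proof.
move=> /ffunP eqr; rewrite /winding !ffunE /= => eqw.
have eqm (i : 'I_n) : (act u i = act v i %[mod N])%N.
  by have := congr1 val (eqr i); rewrite !ffunE.
have eq0 : act u 0 = act v 0.
  by rewrite (divn_eq (act u 0) N) eqw (eqm particle0) -divn_eq.
have window w (i : 'I_n) : (act w 0 <= act w i <= act w 0 + n)%N.
  by rewrite -(act_addn w) add0n !leq_act // ltnW.
move=> p; apply: (@eq_act_mod _ _ _ (p %% n)); first by rewrite modn_mod.
set i := Ordinal (ltn_pmod p (n_gt0 n_ge3)).
have /andP[lu hu] := window u i; have /andP[lv hv] := window v i.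
rewrite -eq0 in lv hv; move: (eqm i) => /eqP.
rewrite -(subnKC lu) -(subnKC lv) eqn_modDl.
have := n_gt0 n_ge3 => ?.
by rewrite !modn_small => [/eqP-> //||]; lia.
Qed.

(** The predecessor gives the matrices a size of the form r.+1, for which they
    form a nontrivial ring. *)
Definition dim := #|{: config}|.-1.

Lemma dimE : dim.+1 = #|{: config}|.
Proof. by apply: prednK; apply/card_gt0P; exists config_id. Qed.

Definition config_of (a : 'I_dim.+1) : config := enum_val (cast_ord dimE a).

Definition index_of (c : config) : 'I_dim.+1 :=
  cast_ord (esym dimE) (enum_rank c).

Lemma config_ofK : cancel config_of index_of.
Proof. by move=> a; rewrite /index_of enum_valK cast_ordK. Qed.

Lemma index_ofK : cancel index_of config_of.
Proof. by move=> c; rewrite /config_of cast_ordKV enum_rankK. Qed.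

Variable K : fieldType.

Definition act_mx u : 'M[{poly K}]_dim.+1 := \matrix_(a, b)
  ('X^(winding u (config_of a)) *+
     (index_of (config_act u (config_of a)) == b)).

Lemma act_mx_nil : act_mx [::] = 1.
Proof.
apply/matrixP => a b.
by rewrite !mxE winding_nil config_act_nil config_ofK.
Qed.

Lemma act_mx_cat u v : act_mx (u ++ v) = act_mx u * act_mx v.
Proof.
apply/matrixP => a b.
rewrite !mxE (bigD1 (index_of (config_act u (config_of a)))) //=.
rewrite big1 ?addr0 => [|c nc]; last first.
  by rewrite !mxE eq_sym (negPf nc) mul0r.
by rewrite !mxE eqxx mulr1n mulrnAr -exprD index_ofK winding_cat config_act_cat.
Qed.

Lemma eq_act_mx u v : act u =1 act v -> act_mx u = act_mx v.
Proof.
move=> equv; apply/matrixP => a b.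
by rewrite !mxE (eq_winding _ equv) (eq_config_act _ equv).
Qed.

Definition hk_mx (x : hk_monoid n) : 'M[{poly K}]_dim.+1 := act_mx (repr x).

Lemma hk_mx_pi u : hk_mx (\pi u)%qT = act_mx u.
Proof. by apply: eq_act_mx; apply: hk_cong_act => //; apply: hk_repr_pi. Qed.

Lemma hk_mx_mmorphism : mmorphism hk_mx.
Proof.
split=> [x y|]; last by rewrite hk_mx_pi act_mx_nil.
elim/hk_monoidW: x => u; elim/hk_monoidW: y => v.
by rewrite hk_mulE !hk_mx_pi act_mx_cat.
Qed.

HB.instance Definition _ :=
  monalg.isMultiplicative.Build _ _ hk_mx hk_mx_mmorphism.

Lemma frac_lift_hk_mx_inj : injective (frac_lift hk_mx).
Proof.
have rowE x b : hk_mx x (index_of config_id) b =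
    'X^(winding (repr x) config_id) *+
      (index_of (config_act (repr x) config_id) == b).
  by rewrite mxE index_ofK.
apply: (frac_lift_inj rowE) => x y /(can_inj index_ofK) eqc eqw.
rewrite -[x]reprK -[y]reprK.
exact: (act_inj n_ge3 (config_id_separates eqc eqw)).
Qed.

End Representation.

Theorem corollary5p11 (n : nat) (n_ge3 : (3 <= n)%N) (K : fieldType) :
  exists (L : fieldType) (iota : {rmorphism K -> L}) (r : nat),
    (1 <= r)%N /\
    exists phi : {lrmorphism {malg K[hk_monoid n]} -> 'M[L]_r | iota \; *:%R},
      injective phi.
Proof.
exists {fraction {poly K}}, (const_frac K), (dim n).+1; split=> //.
exists (frac_lift (hk_mx n_ge3 K)); exact: frac_lift_hk_mx_inj.
Qed.
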